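(* Define four probability measures $\xi^{(1)},\dots,\xi^{(4)}$ on $\{0,1,2,\dots\}$ by: $\xi^{(1)}_0=\xi^{(1)}_2=\tfrac12$; \[\xi^{(2)}_0=2-\sqrt2,\quad \xi^{(2)}_1=0,\quad \xi^{(2)}_i=\Big(\frac{2-\sqrt2}{2}\Big)^{i-1}\ \text{for } i\ge 2;\] $\xi^{(3)}=\xi^{(1)}$; and \[\xi^{(4)}_0=\frac{2\log 2-1}{\log 2},\quad \xi^{(4)}_1=0,\quad \xi^{(4)}_i=\frac{(\log 2)^{i-1}}{i!}\ \text{for } i\ge2.\] For each $i\in\{1,2,3,4\}$ and $n\ge 1$, let $T^i_n$ be distributed like a Galton-Watson tree with offspring distribution $\xi^{(i)}$ conditioned to have exactly $n$ leaves. Then: (1) $T^1_n$ is uniformly distributed on the set of rooted ordered unlabeled binary trees with $n$ leaves (every vertex has out-degree $0$ or $2$), and $T^2_n$ is uniformly distributed on the set of rooted ordered unlabeled trees with $n$ leaves and no vertex of out-degree one. (2) Let $U_n$ be a uniform random ordering of $\{1,\dots,n\}$, independent of the trees, and for $i\in\{3,4\}$ let $\tilde T^i_n$ be constructed from $T^i_n$ by labeling the leaves of $T^i_n$ from left to right by $U_n$ and then forgetting the order structure. Then $\tilde T^3_n$ is uniformly distributed on the set of rooted unordered binary trees with $n$ leaves labeled by $\{1,\dots,n\}$, and $\tilde T^4_n$ is uniformly distributed on the set of rooted unordered trees with $n$ leaves labeled by $\{1,\dots,n\}$ and no vertex of out-degree one.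
   Context: All trees are finite. The out-degree $\deg(v)$ of a vertex $v$ of a rooted tree is its number of children; a leaf is a vertex of out-degree $0$ (so the root is a leaf if and only if it is the only vertex). A rooted ordered tree is a rooted tree in which the children of each vertex are linearly ordered (a plane tree), taken up to root- and order-preserving isomorphism. Leaf-labeled unordered trees are taken up to root- and label-preserving isomorphism (only leaves carry labels, each label in $\{1,\dots,n\}$ used exactly once). ''Binary'' means every vertex has out-degree $0$ or $2$. A Galton-Watson tree with offspring distribution $\xi$ (mean at most one, $\xi_0>0$) is a random rooted ordered tree $T$ with $\mathbb P(T=t)=\prod_{v\in t}\xi_{\deg(v)}$ for every finite rooted ordered tree $t$. The four sets of trees correspond to Schröder's four bracketing problems (binary word bracketings, word bracketings, binary set bracketings, set bracketings). *)

(* Defs.v *)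
From HB Require Import structures.
From mathcomp Require Import all_boot all_order all_algebra all_fingroup.
From mathcomp Require Import all_classical all_reals all_analysis.

Set Implicit Arguments.
Unset Strict Implicit.
Unset Printing Implicit Defensive.

Import Order.TTheory GRing.Theory Num.Theory.
Import numFieldNormedType.Exports.

Local Open Scope classical_set_scope.
Local Open Scope ring_scope.

(* Inhabitants of this type are the finite rooted ordered trees, one for each
   isomorphism class. *)
Inductive ptree : Type := PNode of seq ptree.

(* A vertex is given by the child positions on the path from the root, so the
   root is [::]; the vertices are listed in depth-first, left-to-right order. *)
Fixpoint vertices (t : ptree) : seq (seq nat) :=
  let: PNode cs := t in
  let fix forest (i : nat) (cs : seq ptree) : seq (seq nat) :=
    if cs is c :: cs' then map (cons i) (vertices c) ++ forest i.+1 cs'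
    else [::] in
  [::] :: forest 0%N cs.

Definition is_child (v w : seq nat) : bool :=
  prefix v w && (size w == (size v).+1).

Definition outdeg (t : ptree) (v : seq nat) : nat :=
  count (is_child v) (vertices t).

(* Listed from left to right. *)
Definition leaves (t : ptree) : seq (seq nat) :=
  [seq v <- vertices t | outdeg t v == 0%N].

Definition nleaves (t : ptree) : nat := size (leaves t).

Definition binary (t : ptree) : Prop :=
  forall v, v \in vertices t -> outdeg t v = 0%N \/ outdeg t v = 2%N.

Definition no_unary (t : ptree) : Prop :=
  forall v, v \in vertices t -> outdeg t v <> 1%N.

(* The pair (t, s) stands for t with its k-th leaf from the left carrying the
   label nth 0 s k. *)
Definition ltree : Type := (ptree * seq nat)%type.

Definition leaf_labeled (n : nat) (x : ltree) : Prop :=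
  nleaves x.1 = n /\ perm_eq x.2 (iota 1 n).

Definition label (x : ltree) (v : seq nat) : nat :=
  nth 0%N x.2 (index v (leaves x.1)).

(* The order of the children is not required to be preserved. *)
Definition ltree_iso (x y : ltree) : Prop :=
  exists f : seq nat -> seq nat,
    [/\ set_bij [set` vertices x.1] [set` vertices y.1] f,
        f [::] = [::],
        {in vertices x.1 &, forall v w, is_child (f v) (f w) = is_child v w}
      & {in leaves x.1, forall v, label y (f v) = label x v}].

(* An unordered tree with leaves labeled by {1, ..., n} is encoded as the set of
   all ordered leaf-labeled trees that represent it. *)
Definition forget_order (n : nat) (x : ltree) : set ltree :=
  [set y | leaf_labeled n y /\ ltree_iso x y].

Definition unordered_labeled_trees (n : nat) (Q : ptree -> Prop) :
    set (set ltree) :=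
  [set forget_order n x | x in [set x | leaf_labeled n x /\ Q x.1]].

(* Ordinals start from 0, labels from 1. *)
Definition label_by (n : nat) (t : ptree) (u : 'S_n) : ltree :=
  (t, [seq (u k).+1 | k <- enum 'I_n]).

Section Distributions.
Variable R : realType.

Definition xi1 (k : nat) : R :=
  match k with 0 | 2 => 2^-1 | _ => 0 end.

Definition xi2 (k : nat) : R :=
  match k with
  | 0 => 2 - Num.sqrt 2
  | 1 => 0
  | _ => ((2 - Num.sqrt 2) / 2) ^+ k.-1
  end.

Definition xi3 : nat -> R := xi1.

Definition xi4 (k : nat) : R :=
  match k with
  | 0 => (2 * ln 2 - 1) / ln 2
  | 1 => 0
  | _ => ln 2 ^+ k.-1 / (k`!)%:R
  end.

Definition offspring_distribution (xi : nat -> R) : Prop :=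
  [/\ forall k, 0 <= xi k,
      (\sum_(0 <= k <oo) (xi k)%:E = 1)%E,
      0 < xi 0%N
    & (\sum_(0 <= k <oo) (k%:R * xi k)%:E <= 1)%E].

End Distributions.

Section RandomVariables.
Context (d : measure_display) (Omega : measurableType d) (R : realType).
Variable P : probability Omega R.

(* The value spaces below carry the discrete sigma-algebra. *)
Definition discrete_rv (E : Type) (X : Omega -> E) : Prop :=
  forall A : set E, measurable (X @^-1` A).

Definition uniform_on (E : Type) (X : Omega -> E) (A : set E) : Prop :=
  discrete_rv X /\
  exists m : nat, [/\ (0 < m)%N, (A #= `I_m)%card
    & forall a, A a -> P (X @^-1` [set a]) = (m%:R^-1)%:E].

Definition independent_rv (E F : Type) (X : Omega -> E) (Y : Omega -> F) : Prop :=
  forall (A : set E) (B : set F),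
    P (X @^-1` A `&` Y @^-1` B) = (P (X @^-1` A) * P (Y @^-1` B))%E.

Definition galton_watson (xi : nat -> R) (T : Omega -> ptree) : Prop :=
  discrete_rv T /\
  forall t, P (T @^-1` [set t]) = (\prod_(v <- vertices t) xi (outdeg t v))%:E.

End RandomVariables.

(* The equation with A := setT forces the conditioning event to have positive
   probability. *)
Definition gw_given_leaves (d : measure_display) (Omega : measurableType d)
    (R : realType) (P : probability Omega R) (xi : nat -> R) (n : nat)
    (Tn : Omega -> ptree) : Prop :=
  discrete_rv Tn /\
  exists (d' : measure_display) (Omega' : measurableType d')
         (P' : probability Omega' R) (T : Omega' -> ptree),
    galton_watson P' xi T /\
    forall A : set ptree,
      P (Tn @^-1` A) =
        (fine (P' (T @^-1` A `&` [set w | nleaves (T w) = n])) /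
         fine (P' [set w | nleaves (T w) = n]))%:E.

(* Main.v *)
Require Import Defs.
From HB Require Import structures.
From mathcomp Require Import all_boot all_order all_algebra all_fingroup.
From mathcomp Require Import all_classical all_reals all_analysis.
From mathcomp Require Import ring lra.

(** In a tree with [n] leaves the internal vertices satisfy
    [sum (outdeg v - 1) = n - 1], because each of them replaces one pending
    subtree by [outdeg v] of them.  Hence if an offspring law has
    [xi 0 = a] and [xi k = b ^ (k - 1)] on the allowed positive out-degrees,
    every allowed tree with [n] leaves has the same Galton-Watson weight
    [a ^ n * b ^ (n - 1)], and all other trees have weight 0; conditioning on
    [n] leaves then gives the uniform law.  This is the situation of [xi1]
    (with [a = b = 1/2]) and of [xi2] (with [b = (2 - sqrt 2) / 2]).

    For unordered trees the same computation is applied to [xi k * k!]: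
    [xi3] and [xi4] make it equal to [b ^ (k - 1)], with [b = 1] and
    [b = ln 2].  So the weight of an ordered tree is a constant divided by
    the product of [(outdeg v)!] over its vertices.  On the other hand, an
    unordered tree with distinct leaf labels has exactly that many ordered
    representatives ([iso_class_enumeration]): the subtrees at the children of
    a vertex carry disjoint nonempty sets of labels, so different
    rearrangements of the children, at any set of vertices, are different
    labeled ordered trees.  Since the labeling is uniform and independent of
    the tree, the mass of an unordered tree is the sum of the masses of its
    representatives, and the two products cancel.

    A variable that has one and the same positive mass at each point of a set
    of full measure is uniform on it ([uniform_on_of_const]): the total
    mass being 1, such a set must be finite, and this is where the finiteness
    of the sets of trees comes from.

    That the four laws have total mass 1 and mean at most 1 follows from the
    sums of the geometric series, its derivative and the exponential series. *)

Set Implicit Arguments.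
Unset Strict Implicit.
Unset Printing Implicit Defensive.

Import Order.TTheory GRing.Theory Num.Theory.
Import numFieldNormedType.Exports.

Local Open Scope classical_set_scope.
Local Open Scope ring_scope.

(** * Vertices, out-degrees and leaves of an ordered tree *)

Definition pleaf : ptree := PNode [::].

(** The principle generated for [ptree] gives no hypothesis on the subtrees,
    because they occur inside a list.  Indexing the subtrees by position
    matches the encoding of vertices as paths of child positions. *)
Lemma ptree_nth_ind (A : ptree -> Prop) :
  (forall cs, (forall i, (i < size cs)%N -> A (nth pleaf cs i)) ->
     A (PNode cs)) ->
  forall t, A t.
Proof.
move=> Anode; fix IH 1 => -[cs]; apply: Anode.
elim: cs => [|c cs IHcs] i; first by clear IH; rewrite ltn0.
case: i => [_|i lti]; [exact: IH | exact: IHcs].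
Qed.

Fixpoint encode_ptree (t : ptree) : GenTree.tree unit :=
  let: PNode cs := t in GenTree.Node 0 (map encode_ptree cs).

Fixpoint decode_ptree (g : GenTree.tree unit) : ptree :=
  if g is GenTree.Node _ gs then PNode (map decode_ptree gs) else pleaf.

Lemma encode_ptreeK : cancel encode_ptree decode_ptree.
Proof.
elim/ptree_nth_ind=> cs IH /=; congr PNode; rewrite -map_comp.
apply: (@eq_from_nth _ pleaf); rewrite size_map // => i lti.
by rewrite (nth_map pleaf) //= IH.
Qed.

HB.instance Definition _ := Countable.copy ptree (can_type encode_ptreeK).

(** A named copy of the local recursion in [vertices], to reason on it with an
    arbitrary starting position. *)
Fixpoint forest (i : nat) (cs : seq ptree) : seq (seq nat) :=
  if cs is c :: cs' then map (cons i) (vertices c) ++ forest i.+1 cs'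
  else [::].

Lemma verticesE cs :
  vertices (PNode cs) =
  [::] :: flatten [seq map (cons i) (vertices (nth pleaf cs i))
                  | i <- iota 0 (size cs)].
Proof.
have -> : vertices (PNode cs) = [::] :: forest 0 cs by [].
congr cons.
have: forall k, forest k cs = flatten
   [seq map (cons (k + i)%N) (vertices (nth pleaf cs i))
    | i <- iota 0 (size cs)].
  elim: cs => //= c cs IH k; rewrite addn0 IH (iotaDl 1 0) -map_comp.
  congr (_ ++ flatten _); apply: eq_map => i /=.
  by rewrite addSnnS.
by move/(_ 0%N) => ->.
Qed.

Lemma nil_vertices t : [::] \in vertices t.
Proof. by case: t => cs; rewrite verticesE inE. Qed.

Lemma cons_vertices cs i v :
  (i :: v \in vertices (PNode cs)) =
  (i < size cs)%N && (v \in vertices (nth pleaf cs i)).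
Proof.
rewrite verticesE inE /=; apply/flatten_mapP/andP => [[j]|[lti vv]].
  by rewrite mem_iota => /andP[_ ltj] /mapP[w ww [-> ->]].
by exists i; rewrite ?mem_iota //; apply/mapP; exists v.
Qed.

Lemma uniq_flatten_map (T1 T2 : eqType) (F : T1 -> seq T2) s :
  uniq s -> {in s, forall x, uniq (F x)} ->
  {in s &, forall x y z, z \in F x -> z \in F y -> x = y} ->
  uniq (flatten (map F s)).
Proof.
elim: s => //= x s IH /andP[xs us] uF disjF.
rewrite cat_uniq uF ?mem_head //= IH ?andbT //.
- apply/hasPn => z /flatten_mapP[y ys zy]; apply/negP => zx.
  by rewrite (disjF x y _ _ z) ?ys ?inE ?eqxx ?ys ?orbT in xs.
- by move=> y ys; apply: uF; rewrite inE ys orbT.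
- by move=> y y' ys y's; apply: disjF; rewrite inE ?ys ?y's orbT.
Qed.

Lemma uniq_branches (F : nat -> seq (seq nat)) k :
  (forall i, (i < k)%N -> uniq (F i)) ->
  uniq (flatten [seq map (cons i) (F i) | i <- iota 0 k]).
Proof.
move=> uF; apply: uniq_flatten_map
  => [|i|i j _ _ _ /mapP[v _ ->] /mapP[w _ []]//].
  exact: iota_uniq.
by rewrite mem_iota => /uF ui; rewrite map_inj_uniq // => v w [].
Qed.

Lemma uniq_vertices t : uniq (vertices t).
Proof.
elim/ptree_nth_ind: t => cs IH; rewrite verticesE cons_uniq uniq_branches //.
by rewrite andbT; apply/negP => /flatten_mapP[j _ /mapP[]].
Qed.

Lemma vertices_rcons t v a : rcons v a \in vertices t -> v \in vertices t.
Proof.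
elim: v t => [|i v IH] [cs]; first by rewrite nil_vertices.
by rewrite rcons_cons !cons_vertices => /andP[-> /IH].
Qed.

Lemma is_childP v w : reflect (exists a, w = rcons v a) (is_child v w).
Proof.
apply: (iffP andP) => [[/prefixP[s ->]]|[a ->]].
  rewrite size_cat; case: s => [|a [|b s]] /eqP /= => [|_|].
  - by rewrite addn0 => /n_Sn.
  - by exists a; rewrite cats1.
  - by rewrite addnS => /eqP; rewrite eqSS -{2}[size v]addn0 eqn_add2l.
by rewrite -cats1 prefix_prefix size_cat addn1.
Qed.

Lemma is_child_cons i v j w :
  is_child (i :: v) (j :: w) = (i == j) && is_child v w.
Proof. by rewrite /is_child /= eqSS andbA. Qed.

Lemma is_child_nil j w : is_child [::] (j :: w) = (w == [::]).
Proof. by rewrite /is_child /= eqSS size_eq0. Qed.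

Lemma outdeg_root cs : outdeg (PNode cs) [::] = size cs.
Proof.
rewrite /outdeg verticesE /= count_flatten -map_comp.
rewrite (eq_map (g := fun=> 1%N)); last first.
  move=> i /=; rewrite count_map; case: (nth _ _ _) => ds.
  rewrite verticesE /= count_flatten -map_comp (eq_map (g := fun=> 0%N)).
    by rewrite sumnE big_map big1 ?addn0.
  by move=> j /=; rewrite count_map (eq_count (a2 := pred0)) ?count_pred0.
rewrite sumnE big_map big_const_seq iter_addn mul1n addn0 count_predT.
by rewrite size_iota.
Qed.

Lemma outdeg_cons cs i v : (i < size cs)%N ->
  outdeg (PNode cs) (i :: v) = outdeg (nth pleaf cs i) v.
Proof.
move=> lti; rewrite /outdeg verticesE /= count_flatten -map_comp sumnE big_map.
rewrite (bigD1_seq i) ?mem_iota ?iota_uniq //= big1 ?addn0 => [|j /negPf ji].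
  by rewrite count_map; apply: eq_count => w; rewrite /= is_child_cons eqxx.
rewrite count_map (eq_count (a2 := pred0)) ?count_pred0 // => w /=.
by rewrite is_child_cons eq_sym ji.
Qed.

Lemma leaves_pleaf : leaves pleaf = [:: [::]].
Proof. by []. Qed.

Lemma leaves_node cs : (0 < size cs)%N ->
  leaves (PNode cs) = flatten [seq map (cons i) (leaves (nth pleaf cs i))
                              | i <- iota 0 (size cs)].
Proof.
move=> cs0; rewrite /leaves verticesE /= outdeg_root.
rewrite -[_ == _]negbK -lt0n cs0 /= filter_flatten -map_comp; congr flatten.
apply/eq_in_map => i; rewrite mem_iota => /andP[_ lti] /=.
by rewrite filter_map; congr map; apply: eq_filter => v; rewrite /= outdeg_cons.
Qed.

Lemma nleaves_pleaf : nleaves pleaf = 1%N.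
Proof. by rewrite /nleaves leaves_pleaf. Qed.

Lemma nleaves_node cs : (0 < size cs)%N ->
  nleaves (PNode cs) = sumn (map nleaves cs).
Proof.
move=> cs0; rewrite /nleaves leaves_node // size_flatten /shape -map_comp.
rewrite -[in RHS](mkseq_nth pleaf cs) /mkseq -map_comp; congr sumn.
by apply: eq_map => i /=; rewrite size_map.
Qed.

Lemma nleaves_gt0 t : (0 < nleaves t)%N.
Proof.
elim/ptree_nth_ind: t => -[|c cs] IH; first by rewrite nleaves_pleaf.
by rewrite nleaves_node //= addn_gt0 (IH 0%N).
Qed.

Lemma uniq_leaves t : uniq (leaves t).
Proof. exact/filter_uniq/uniq_vertices. Qed.

Lemma cons_leaves cs i v :
  (i :: v \in leaves (PNode cs)) =
  (i < size cs)%N && (v \in leaves (nth pleaf cs i)).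
Proof.
rewrite !mem_filter cons_vertices andbCA; have [lti|//] := boolP (i < _)%N.
by rewrite outdeg_cons.
Qed.

Lemma big_outdeg_node (S : Type) (idx : S) (op : Monoid.law idx)
    (F : nat -> S) cs :
  \big[op/idx]_(v <- vertices (PNode cs)) F (outdeg (PNode cs) v) =
  op (F (size cs))
     (\big[op/idx]_(c <- cs) \big[op/idx]_(v <- vertices c) F (outdeg c v)).
Proof.
rewrite verticesE big_cons outdeg_root; congr (op _ _).
rewrite big_flatten big_map [RHS](big_nth pleaf) /index_iota subn0.
apply: eq_big_seq => i; rewrite mem_iota => /andP[_ lti].
by rewrite big_map; apply: eq_bigr => v _; rewrite outdeg_cons.
Qed.

(** * Labeled trees as a root with labeled subtrees *)

Definition fully_labeled (x : ltree) : bool := size x.2 == nleaves x.1.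

(** The labels are listed from left to right, so the tree with root subtrees
    [ys] lists the labels of the first subtree, then those of the second, and
    so on.  The list is meant to be nonempty: a tree with a single vertex has a
    leaf, hence one label. *)
Definition glue (ys : seq ltree) : ltree :=
  (PNode (unzip1 ys), flatten (unzip2 ys)).

Definition lleaf (l : nat) : ltree := (pleaf, [:: l]).

Lemma fully_labeled_glue ys :
  (0 < size ys)%N -> all fully_labeled ys -> fully_labeled (glue ys).
Proof.
move=> ys0 /allP wfys; rewrite /fully_labeled nleaves_node ?size_map //=.
rewrite size_flatten /shape -!map_comp; apply/eqP; congr sumn.
by apply/eq_in_map => y /wfys /eqP.
Qed.

Lemma fully_labeledP x : fully_labeled x -> (exists l, x = lleaf l) \/
  exists ys, [/\ (0 < size ys)%N, all fully_labeled ys & x = glue ys].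
Proof.
case: x => -[[|c cs]] s; rewrite /fully_labeled.
  rewrite nleaves_pleaf /=; case: s => [|l [|]] //= _; left; by exists l.
set cs' := c :: cs; rewrite nleaves_node // => /eqP /= sz; right.
pose ss := reshape (map nleaves cs') s.
have shs : shape ss = map nleaves cs' by apply: reshapeKl; rewrite sz.
have szs : size ss = size cs'.
  by rewrite -(size_map size) -/(shape ss) shs size_map.
exists (zip cs' ss); split.
- by rewrite size_zip szs minnn.
- apply/(all_nthP (pleaf, [::])) => i; rewrite size_zip szs minnn => lti.
  rewrite nth_zip ?szs // /fully_labeled /= -(nth_map _ 0%N) ?szs //.
  by rewrite -/(shape ss) shs (nth_map pleaf).
- rewrite /glue /unzip1 /unzip2 -/(unzip1 _) -/(unzip2 _) unzip1_zip ?szs //.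
  by rewrite unzip2_zip ?szs // reshapeKr ?sz.
Qed.

(** This determines [label x] on the leaves, which spares any computation with
    positions in the concatenated list of leaves. *)
Lemma map_label x : fully_labeled x -> map (label x) (leaves x.1) = x.2.
Proof.
move=> /eqP sz; apply: (@eq_from_nth _ 0%N); rewrite size_map // => i lti.
by rewrite (nth_map [::]) // /label index_uniq // uniq_leaves.
Qed.

Definition ltree0 : ltree := (pleaf, [::]).

Lemma nth_unzip1 (ys : seq ltree) i :
  nth pleaf (unzip1 ys) i = (nth ltree0 ys i).1.
Proof.
have [lti|gei] := ltnP i (size ys); first by rewrite (nth_map ltree0).
by rewrite !nth_default ?size_map.
Qed.

Lemma label_glue ys i v : all fully_labeled ys -> (i < size ys)%N ->
  v \in leaves (nth ltree0 ys i).1 ->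
  label (glue ys) (i :: v) = label (nth ltree0 ys i) v.
Proof.
move=> wfys lti vl; have ys0 : (0 < size ys)%N by case: ys lti {wfys vl}.
pose g u := label (nth ltree0 ys (head 0%N u)) (behead u).
have : map (label (glue ys)) (leaves (glue ys).1) = map g (leaves (glue ys).1).
  rewrite map_label ?fully_labeled_glue //.
  rewrite leaves_node ?size_map //= map_flatten.
  rewrite -{1}(mkseq_nth ltree0 ys) /mkseq /unzip2 -!map_comp; congr flatten.
  apply/eq_in_map => j; rewrite mem_iota => /andP[_ ltj] /=.
  rewrite -map_comp nth_unzip1 -[LHS]map_label //.
  by move/allP: wfys; apply; rewrite mem_nth.
move/eq_in_map => /(_ (i :: v)); apply.
by rewrite cons_leaves size_map lti nth_unzip1.
Qed.

(** * Isomorphisms of labeled trees *)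

Definition iso_by (f : seq nat -> seq nat) (x y : ltree) :=
  [/\ set_bij [set` vertices x.1] [set` vertices y.1] f,
        f [::] = [::],
        {in vertices x.1 &, forall v w, is_child (f v) (f w) = is_child v w}
      & {in leaves x.1, forall v, label y (f v) = label x v}].

Lemma vertices_bij (f : seq nat -> seq nat) (x y : ltree) :
  (forall u, u \in vertices x.1 -> f u \in vertices y.1) ->
  {in vertices x.1 &, injective f} ->
  (forall w, w \in vertices y.1 -> exists2 u, u \in vertices x.1 & f u = w) ->
  set_bij [set` vertices x.1] [set` vertices y.1] f.
Proof.
by move=> fs finj fsurj; split=> // u v /set_mem uv /set_mem vv; apply: finj.
Qed.

Lemma iso_by_perm_vertices f x y : iso_by f x y ->
  perm_eq (map f (vertices x.1)) (vertices y.1).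
Proof.
move=> [[fsub finj fsurj] _ _ _]; apply: uniq_perm; rewrite ?uniq_vertices //.
  rewrite map_inj_in_uniq ?uniq_vertices // => u v uv vv.
  by apply: finj; rewrite inE.
move=> w; apply/mapP/idP => [[v vv ->]|/fsurj [v vv <-]]; first exact: fsub.
by exists v.
Qed.

(** Out-degrees count children, and an isomorphism maps the children of [v]
    bijectively to those of [f v]. *)
Lemma iso_by_outdeg f x y v : iso_by f x y -> v \in vertices x.1 ->
  outdeg y.1 (f v) = outdeg x.1 v.
Proof.
move=> fiso vv; have/seq.permP p := iso_by_perm_vertices fiso.
rewrite /outdeg -p count_map; apply: eq_in_count => w wv /=.
by have [_ _ -> //] := fiso.
Qed.

Lemma iso_by_perm_leaves f x y : iso_by f x y ->
  perm_eq (map f (leaves x.1)) (leaves y.1).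
Proof.
move=> fiso; rewrite /leaves.
apply: perm_trans (perm_filter _ (iso_by_perm_vertices fiso)).
rewrite filter_map; apply/seq.permP => p; congr (count p (map f _)).
by apply: eq_in_filter => v vv /=; rewrite (iso_by_outdeg fiso).
Qed.

Lemma ltree_iso_perm_labels x y :
  fully_labeled x -> fully_labeled y -> ltree_iso x y ->
  perm_eq x.2 y.2.
Proof.
move=> wfx wfy [f fiso]; rewrite -(map_label wfx) -(map_label wfy).
have := perm_map (label y) (iso_by_perm_leaves fiso).
apply: perm_trans; rewrite -map_comp.
have [_ _ _ fl] := fiso; apply/seq.permP => p; congr (count p _).
by apply/eq_in_map => v /fl.
Qed.

Lemma ltree_iso_outdeg_root x y : ltree_iso x y ->
  outdeg x.1 [::] = outdeg y.1 [::].
Proof.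
move=> [f fiso]; rewrite -(iso_by_outdeg fiso (nil_vertices _)).
by have [_ -> _ _] := fiso.
Qed.

Lemma ltree_iso_nleaves x y : ltree_iso x y -> nleaves x.1 = nleaves y.1.
Proof.
by move=> [f /iso_by_perm_leaves /perm_size]; rewrite size_map.
Qed.

Lemma ltree_iso_big (S : Type) (idx : S) (op : Monoid.com_law idx)
    (F : nat -> S) x y : ltree_iso x y ->
  \big[op/idx]_(v <- vertices x.1) F (outdeg x.1 v) =
  \big[op/idx]_(v <- vertices y.1) F (outdeg y.1 v).
Proof.
move=> [f fiso]; rewrite -(perm_big _ (iso_by_perm_vertices fiso)) big_map /=.
by apply: eq_big_seq => v vv; rewrite (iso_by_outdeg fiso).
Qed.

Lemma ltree_iso_outdeg x y (D : nat -> Prop) : ltree_iso x y ->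
  (forall v, v \in vertices x.1 -> D (outdeg x.1 v)) ->
  forall v, v \in vertices y.1 -> D (outdeg y.1 v).
Proof.
move=> [f fiso] Dx v; rewrite -(perm_mem (iso_by_perm_vertices fiso)).
by move=> /mapP[w ww ->]; rewrite (iso_by_outdeg fiso) //; apply: Dx.
Qed.

Lemma ltree_iso_refl x : ltree_iso x x.
Proof. by exists id; split=> //; split=> // v vv; exists v. Qed.

Lemma ltree_iso_trans x y z : ltree_iso x y -> ltree_iso y z -> ltree_iso x z.
Proof.
move=> [f fiso] [g giso]; exists (g \o f).
have fv v : v \in vertices x.1 -> f v \in vertices y.1.
  by case: fiso => -[fs _ _] _ _ _ /fs.
have fl v : v \in leaves x.1 -> f v \in leaves y.1.
  by move=> vl; rewrite -(perm_mem (iso_by_perm_leaves fiso)); apply: map_f.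
case: fiso giso => [fb f0 fc flab] [gb g0 gc glab]; split => /=.
- exact: set_bij_comp gb.
- by rewrite f0.
- by move=> v w vv wv; rewrite gc ?fc ?fv.
- by move=> v vl; rewrite glab ?fl // flab.
Qed.

Lemma ltree_iso_sym x y : ltree_iso x y -> ltree_iso y x.
Proof.
move=> [f fiso].
have pv := perm_mem (iso_by_perm_vertices fiso).
have pl := perm_mem (iso_by_perm_leaves fiso).
pose g w := nth [::] (vertices x.1) (index w (map f (vertices x.1))).
have [[fs finj _] f0 fc fl] := fiso.
have gf v : v \in vertices x.1 -> g (f v) = v.
  move=> vv; have fvm := map_f f vv.
  have lti : (index (f v) (map f (vertices x.1)) < size (vertices x.1))%N.
    by rewrite -(size_map f) index_mem.
  have gv : g (f v) \in vertices x.1 by exact: mem_nth.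
  by apply: finj; rewrite ?inE // /g -(nth_map [::] [::] f lti) nth_index.
have gP w : w \in vertices y.1 -> exists2 v, v \in vertices x.1 & w = f v.
  by rewrite -pv => /mapP.
exists g; split.
- apply: vertices_bij.
  + by move=> w /gP[v vv ->]; rewrite gf.
  + move=> u w /gP[u' uv ->] /gP[w' wv ->].
    by rewrite !gf // => ->.
  + by move=> v vv; exists (f v); [exact: fs | exact: gf].
- by rewrite -{1}f0 gf // nil_vertices.
- by move=> u w /gP[u' uv ->] /gP[w' wv ->]; rewrite !gf // fc.
- move=> w; rewrite -pl => /mapP[v vl ->]; rewrite gf ?fl //.
  by move: vl; rewrite mem_filter => /andP[].
Qed.

Lemma nil_leaves cs : (0 < size cs)%N -> ([::] \in leaves (PNode cs)) = false.
Proof. by move=> cs0; rewrite mem_filter outdeg_root -leqn0 leqNgt cs0. Qed.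

(** Isomorphic copies of the subtrees may be put at the root in any order: the
    isomorphism sends the child position [i] to [nth 0 p i] and follows the
    isomorphism of subtrees below. *)
Lemma glue_iso_intro ys zs (p : seq nat) :
  (0 < size ys)%N -> all fully_labeled ys -> all fully_labeled zs ->
  size ys = size zs ->
  perm_eq p (iota 0 (size zs)) ->
  (forall i, (i < size ys)%N ->
     ltree_iso (nth ltree0 ys i) (nth ltree0 zs (nth 0%N p i))) ->
  ltree_iso (glue ys) (glue zs).
Proof.
move=> ys0 wfys wfzs eqsz pp isoP.
have szp : size p = size ys by rewrite (perm_size pp) size_iota.
have ltp i : (i < size ys)%N -> (nth 0%N p i < size zs)%N.
  move=> lti; have : nth 0%N p i \in iota 0 (size zs).
    by rewrite -(perm_mem pp) mem_nth // szp.
  by rewrite mem_iota.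
have injp i j : (i < size ys)%N -> (j < size ys)%N ->
    nth 0%N p i = nth 0%N p j -> i = j.
  move=> lti ltj /eqP; rewrite nth_uniq ?szp ?(perm_uniq pp) ?iota_uniq //.
  by move/eqP.
have surjp j : (j < size zs)%N -> exists2 i, (i < size ys)%N & nth 0%N p i = j.
  move=> ltj; have jp : j \in p by rewrite (perm_mem pp) mem_iota.
  by exists (index j p); rewrite ?nth_index // -szp index_mem.
have /choice[h hP] : forall i, exists f, (i < size ys)%N ->
    iso_by f (nth ltree0 ys i) (nth ltree0 zs (nth 0%N p i)).
  by move=> i; have [/isoP[f fP]|gei] := ltnP i (size ys);
     [exists f | exists id].
pose f u := if u is i :: v then nth 0%N p i :: h i v else [::].
have verty i v : (i :: v \in vertices (glue ys).1) =
    (i < size ys)%N && (v \in vertices (nth ltree0 ys i).1).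
  by rewrite cons_vertices size_map nth_unzip1.
have vertz i v : (i :: v \in vertices (glue zs).1) =
    (i < size zs)%N && (v \in vertices (nth ltree0 zs i).1).
  by rewrite cons_vertices size_map nth_unzip1.
exists f; split => //.
- apply: vertices_bij.
  + move=> [|i v]; first by rewrite nil_vertices.
    rewrite verty vertz => /andP[lti vv]; rewrite ltp //=.
    by have [[hs _ _] _ _ _] := hP _ lti; exact: hs.
  + move=> [|i v] [|j w] //; rewrite !verty.
    move=> /andP[lti vv] /andP[ltj wv] [/injp eqij].
    have {}eqij := eqij lti ltj.
    rewrite -eqij in wv *; have [[_ hinj _] _ _ _] := hP _ lti.
    by move=> /hinj ->; rewrite ?inE.
  + move=> [|j w]; first by exists [::] => //; rewrite nil_vertices.
    rewrite vertz => /andP[/surjp[i lti <-]].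
    have [[_ _ hsurj] _ _ _] := hP _ lti.
    by move=> /hsurj[v vv <-]; exists (i :: v); rewrite //= verty lti.
- move=> [|i v] [|j w] //; rewrite !verty /=.
  + move=> _ /andP[ltj wv]; have [[_ hinj _] h0 _ _] := hP _ ltj.
    rewrite !is_child_nil; apply/eqP/eqP => [hw0|->]; last exact: h0.
    apply: (hinj w [::] (mem_set wv) (mem_set (nil_vertices _))).
    by rewrite hw0 h0.
  + move=> /andP[lti vv] /andP[ltj wv]; rewrite !is_child_cons.
    have [eqij|neij] := eqVneq i j.
      rewrite -eqij in wv *; rewrite !eqxx /=.
      by have [_ _ hc _] := hP _ lti; apply: hc.
    by rewrite (negPf (_ : nth 0%N p i != nth 0%N p j)) //;
       apply: contra neij => /eqP /injp ->.
- move=> [|i v]; first by rewrite nil_leaves ?size_map.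
  rewrite cons_leaves size_map nth_unzip1 => /andP[lti vl] /=.
  have hl := iso_by_perm_leaves (hP _ lti).
  rewrite !label_glue ?ltp //; last by rewrite -(perm_mem hl) map_f.
  by have [_ _ _ ->] := hP _ lti.
Qed.

(** Conversely an isomorphism permutes the children of the root and, being
    compatible with the child relation, maps the subtree below each of them onto
    the subtree below its image.  Together with [glue_iso_intro] this replaces
    bijections between vertices by a recursive description of isomorphism. *)
Lemma glue_iso_elim ys y :
  (0 < size ys)%N -> all fully_labeled ys -> fully_labeled y ->
  ltree_iso (glue ys) y ->
  exists zs p,
    [/\ y = glue zs, all fully_labeled zs, size ys = size zs,
        perm_eq p (iota 0 (size zs))
      & forall i, (i < size ys)%N ->
          ltree_iso (nth ltree0 ys i) (nth ltree0 zs (nth 0%N p i))].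
Proof.
move=> ys0 wfys wfy [f fiso].
have [[fsub finj' fsurj] f0 fc fl] := fiso.
have finj : {in vertices (glue ys).1 &, injective f}.
  by move=> u v uv vv; apply: finj'; apply: mem_set.
have fs u : u \in vertices (glue ys).1 -> f u \in vertices y.1 by move/fsub.
have := iso_by_outdeg fiso (nil_vertices _); rewrite f0 outdeg_root size_map.
have [[l eqy]|[zs [zs0 wfzs eqy]]] := fully_labeledP wfy.
  by rewrite eqy outdeg_root => eqsz; rewrite -eqsz in ys0.
rewrite eqy outdeg_root size_map => eqsz; subst y.
have verty i v : (i :: v \in vertices (glue ys).1) =
    (i < size ys)%N && (v \in vertices (nth ltree0 ys i).1).
  by rewrite cons_vertices size_map nth_unzip1.
have vertz i v : (i :: v \in vertices (glue zs).1) =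
    (i < size zs)%N && (v \in vertices (nth ltree0 zs i).1).
  by rewrite cons_vertices size_map nth_unzip1.
pose sg i := head 0%N (f [:: i]).
have fsg i : (i < size ys)%N -> f [:: i] = [:: sg i].
  move=> lti; have iv : [:: i] \in vertices (glue ys).1.
    by rewrite verty lti nil_vertices.
  have := fc [::] [:: i] (nil_vertices _) iv; rewrite f0 => /is_childP[a fi].
  by rewrite /sg fi.
have ltsg i : (i < size ys)%N -> (sg i < size zs)%N.
  move=> lti; have : f [:: i] \in vertices (glue zs).1.
    by apply: fs; rewrite verty lti nil_vertices.
  by rewrite fsg // vertz => /andP[].
have fcons i v : (i < size ys)%N -> v \in vertices (nth ltree0 ys i).1 ->
    f (i :: v) = sg i :: behead (f (i :: v)).
  move=> lti; elim/last_ind: v => [|v a IH] vv; first by rewrite fsg.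
  have vv' := vertices_rcons vv.
  have := fc (i :: v) (i :: rcons v a); rewrite !verty lti => /(_ vv' vv).
  have cva : is_child v (rcons v a) by apply/is_childP; exists a.
  rewrite is_child_cons eqxx cva.
  by move=> /is_childP[b ->]; rewrite (IH vv').
have injsg i j : (i < size ys)%N -> (j < size ys)%N -> sg i = sg j -> i = j.
  move=> lti ltj eqij; suff [] : [:: i] = [:: j] by [].
  by apply: finj; rewrite ?verty ?lti ?ltj ?nil_vertices // !fsg // eqij.
exists zs, (mkseq sg (size ys)); split=> //.
  have usg : uniq (mkseq sg (size ys)).
    rewrite map_inj_in_uniq ?iota_uniq // => i j.
    by rewrite !mem_iota => /andP[_ lti] /andP[_ ltj]; apply: injsg.
  apply: uniq_perm; rewrite ?iota_uniq //.
  apply: (uniq_min_size usg _ _).2; rewrite ?size_mkseq ?size_iota ?eqsz //.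
  move=> _ /mapP[i + ->]; rewrite !mem_iota => /andP[_ lti].
  by rewrite -eqsz ltsg.
move=> i lti; rewrite nth_mkseq //; exists (fun v => behead (f (i :: v))).
split.
- apply: vertices_bij.
  + move=> v vv; have := fs (i :: v); rewrite verty lti.
    by move=> /(_ vv); rewrite fcons // vertz => /andP[].
  + move=> v w vv wv eqvw.
    suff [] : i :: v = i :: w by [].
    by apply: finj; rewrite ?verty ?lti // fcons // eqvw -fcons.
  + move=> w wv; have [] := fsurj (sg i :: w).
      by have := vertz (sg i) w; rewrite ltsg // wv.
    move=> [|j v]; rewrite ?f0 // => jv.
    have := verty j v; rewrite [LHS]jv => /esym/andP[ltj vv].
    rewrite fcons //.
    move=> [/injsg eqij]; rewrite -(eqij ltj lti) in vv *.
    by exists v; rewrite // [LHS]/= .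
- by rewrite fsg.
- move=> v w vv wv; have := fc (i :: v) (i :: w); rewrite !verty lti.
  by move=> /(_ vv wv); rewrite fcons // (fcons _ w) // !is_child_cons !eqxx.
- move=> v vl; have vl' : i :: v \in leaves (glue ys).1.
    by rewrite cons_leaves size_map nth_unzip1 lti.
  have := fl _ vl'; have : f (i :: v) \in leaves (glue zs).1.
    by rewrite -(perm_mem (iso_by_perm_leaves fiso)) map_f.
  rewrite fcons //; last by move: vl; rewrite mem_filter => /andP[].
  rewrite cons_leaves size_map nth_unzip1 => /andP[lts fvl].
  by rewrite !label_glue.
Qed.

(** * Number of ordered representatives of an unordered tree *)

Lemma ltree_glue_ind (A : ltree -> Prop) :
  (forall l, A (lleaf l)) ->
  (forall ys, (0 < size ys)%N -> all fully_labeled ys ->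
     (forall i, (i < size ys)%N -> A (nth ltree0 ys i)) -> A (glue ys)) ->
  forall x, fully_labeled x -> A x.
Proof.
move=> Aleaf Aglue [t s]; elim/ptree_nth_ind: t s => cs IH s wfx.
have [[l ->] //|[ys [ys0 wfys eqx]]] := fully_labeledP wfx.
rewrite eqx; apply: Aglue => // i lti.
have [eqcs _] : cs = unzip1 ys /\ s = flatten (unzip2 ys) by case: eqx.
rewrite (surjective_pairing (nth _ _ _)) -nth_unzip1 -eqcs; apply: IH.
  by rewrite eqcs size_map.
by rewrite eqcs nth_unzip1 -surjective_pairing; apply: (all_nthP _ wfys).
Qed.

Lemma glue_inj : {in all fully_labeled &, injective glue}.
Proof.
move=> ys zs wfys wfzs [eq1 eq2].
have shape2 us : all fully_labeled us ->
    shape (unzip2 us) = map nleaves (unzip1 us).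
  move=> /allP wfus; rewrite /shape -!map_comp.
  by apply/eq_in_map => u /wfus/eqP.
rewrite -(zip_unzip ys) -(zip_unzip zs) eq1; congr zip.
by apply: eq_from_flatten_shape => //; rewrite !shape2 // eq1.
Qed.

Lemma uniq_flatten_index (T : eqType) (ss : seq (seq T)) i j a :
  uniq (flatten ss) -> a \in nth [::] ss i -> a \in nth [::] ss j -> i = j.
Proof.
elim: ss i j => [|s ss IH] i j; first by rewrite nth_nil.
have flat k : a \in nth [::] ss k -> a \in flatten ss.
  have [ltk ak|gek] := ltnP k (size ss); last by rewrite nth_default.
  by apply/flattenP; exists (nth [::] ss k); rewrite ?mem_nth.
rewrite /= cat_uniq => /and3P[_ /hasPn disj uss].
case: i j => [|i] [|j] //= ai aj.
- by move: (disj _ (flat _ aj)); rewrite ai.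
- by move: (disj _ (flat _ ai)); rewrite aj.
- by rewrite (IH i j).
Qed.

Fixpoint choices (T : Type) (rs : seq (seq T)) : seq (seq T) :=
  if rs is r :: rs' then [seq z :: zs | z <- r, zs <- choices rs']
  else [:: [::]].

Lemma size_choices (T : Type) (rs : seq (seq T)) :
  size (choices rs) = (\prod_(r <- rs) size r)%N.
Proof.
by elim: rs => [|r rs IH] /=; rewrite ?big_nil // size_allpairs IH big_cons.
Qed.

Lemma mem_choices (T : eqType) (a : T) (rs : seq (seq T)) zs :
  reflect (size zs = size rs /\
           forall i, (i < size rs)%N -> nth a zs i \in nth [::] rs i)
    (zs \in choices rs).
Proof.
elim: rs zs => [|r rs IH] zs /=.
  by rewrite inE; apply: (iffP eqP) => [->|[/size0nil]].
apply: (iffP allpairsP) => [[[z zs'] /= [zr /IH[sz zsr] ->]]|].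
  by split=> /= [|[|i]] //; [rewrite sz | apply: zsr].
case: zs => [[]|z zs [[sz] zsr]] //; exists (z, zs); split => //=.
  exact: (zsr 0%N).
by apply/IH; split=> // i lti; apply: (zsr i.+1).
Qed.

Lemma choices_uniq (T : eqType) (rs : seq (seq T)) :
  all uniq rs -> uniq (choices rs).
Proof.
elim: rs => //= r rs IH /andP[ur urs].
by apply: allpairs_uniq; rewrite ?IH // => -[z zs] [w ws] _ _ [-> ->].
Qed.

(** The trees isomorphic to [glue ys] are obtained by choosing a representative
    of each subtree and then an order of these representatives.  No tree is
    obtained twice, since the subtrees carry disjoint nonempty sets of labels:
    from the labels one reads which subtree of [ys] each root subtree stands
    for. *)
Lemma iso_class_enumeration x : fully_labeled x -> uniq x.2 ->
  exists r : seq ltree,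
    [/\ uniq r, forall y, (y \in r) <-> (fully_labeled y /\ ltree_iso x y)
      & size r = (\prod_(v <- vertices x.1) (outdeg x.1 v)`!)%N].
Proof.
move: x; apply: ltree_glue_ind => [l _|ys ys0 wfys IH uys].
  exists [:: lleaf l]; split=> // [y|]; last first.
    by rewrite /= big_seq1 outdeg_root.
  rewrite inE; split=> [/eqP ->|[wfy isoy]].
    by split; [exact: eqxx | exact: ltree_iso_refl].
  have [[l' eqy]|[zs [zs0 _ eqy]]] := fully_labeledP wfy.
    have := ltree_iso_perm_labels (isT : fully_labeled (lleaf l)) wfy isoy.
    by rewrite eqy /= => /perm_small_eq => /(_ isT) [->].
  have := ltree_iso_outdeg_root isoy; rewrite eqy !outdeg_root size_map.
  by case: (zs) zs0.
have /choice[R RP] i : exists r : seq ltree, (i < size ys)%N ->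
    [/\ uniq r, forall y, (y \in r) <->
          (fully_labeled y /\ ltree_iso (nth ltree0 ys i) y)
      & size r = (\prod_(v <- vertices (nth ltree0 ys i).1)
                        (outdeg (nth ltree0 ys i).1 v)`!)%N].
  have [lti|gei] := ltnP i (size ys); last by exists [::].
  have [|r rP] := IH i lti; last by exists r.
  have lti2 : (i < size (unzip2 ys))%N by rewrite size_map.
  move: uys; rewrite /= -(cat_take_drop i (unzip2 ys)) (drop_nth [::]) //.
  rewrite flatten_cat /= !cat_uniq => /and3P[_ _ /and3P[+ _ _]].
  by rewrite (nth_map ltree0).
pose rs := mkseq R (size ys).
have chP zs : zs \in choices rs <-> size zs = size ys /\
    forall i, (i < size ys)%N ->
      fully_labeled (nth ltree0 zs i) /\
      ltree_iso (nth ltree0 ys i) (nth ltree0 zs i).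
  split=> [/(mem_choices ltree0)|]; rewrite ?size_mkseq => -[sz zsR].
    split=> // i lti; have [_ <- _] := RP _ lti.
    by have := zsR _ lti; rewrite nth_mkseq.
  apply/(mem_choices ltree0); rewrite size_mkseq; split=> // i lti.
  by rewrite nth_mkseq //; have [_ -> _] := RP _ lti; apply: zsR.
have wf_ch zs : zs \in choices rs -> all fully_labeled zs.
  by move=> /chP[sz zsP]; apply/(all_nthP ltree0) => i; rewrite sz => /zsP[].
(* A tree isomorphic to both the i-th and the j-th subtree has a label, which
   occurs in both, while all labels are distinct. *)
have sep i j z : (i < size ys)%N -> (j < size ys)%N -> fully_labeled z ->
    ltree_iso (nth ltree0 ys i) z -> ltree_iso (nth ltree0 ys j) z -> i = j.
  move=> lti ltj wfz isoi isoj.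
  have wfn k : (k < size ys)%N -> fully_labeled (nth ltree0 ys k).
    exact/all_nthP.
  have pi := ltree_iso_perm_labels (wfn _ lti) wfz isoi.
  have pj := ltree_iso_perm_labels (wfn _ ltj) wfz isoj.
  have : (0 < size z.2)%N by rewrite (eqP wfz) nleaves_gt0.
  case: z.2 pi pj => // l s /perm_mem pi /perm_mem pj _.
  apply: (uniq_flatten_index (a := l) uys); rewrite (nth_map ltree0) //.
    by rewrite pi mem_head.
  by rewrite pj mem_head.
have uch zs : zs \in choices rs -> uniq zs.
  move=> /chP[sz zsP]; apply/(uniqP ltree0) => i j; rewrite !inE sz => lti ltj.
  have [wfi isoi] := zsP _ lti; have [_ isoj] := zsP _ ltj.
  by move=> eqij; apply: (sep i j _ lti ltj wfi isoi); rewrite eqij.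
pose r := flatten (map (@permutations _) (choices rs)).
exists (map glue r); split.
- rewrite map_inj_in_uniq.
    apply: uniq_flatten_map => [|zs _|zs zs' zsc zs'c us].
    + apply: choices_uniq; apply/(all_nthP [::]) => i.
      by rewrite size_mkseq => lti; rewrite nth_mkseq //; have [] := RP _ lti.
    + exact: permutations_uniq.
    rewrite !mem_permutations => /perm_mem zsu /perm_mem zs'u.
    move/chP: (zsc) => [sz zsP]; move/chP: (zs'c) => [sz' zs'P].
    apply: (@eq_from_nth _ ltree0) => [|i]; rewrite sz ?sz' // => lti.
    have : nth ltree0 zs i \in zs' by rewrite -zs'u zsu mem_nth ?sz.
    move=> /(nthP ltree0)[j]; rewrite sz' => ltj eqj.
    have [wfi isoi] := zsP _ lti; have [_ isoj] := zs'P _ ltj.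
    by rewrite -eqj (sep i j _ lti ltj wfi isoi) // -eqj.
  have wfr us : us \in r -> all fully_labeled us.
    move=> /flatten_mapP[zs /wf_ch wfzs]; rewrite mem_permutations => /perm_all.
    by move=> ->.
  by move=> us us' /wfr wfus /wfr wfus'; apply: glue_inj.
- move=> y; split=> [/mapP[us /flatten_mapP[zs zsc +] ->]|[wfy isoy]].
    rewrite mem_permutations => pus; have wfus : all fully_labeled us.
      by rewrite (perm_all _ pus) wf_ch.
    move/chP: (zsc) => [sz zsP]; have szu : size us = size ys.
      by rewrite (perm_size pus).
    split; first by rewrite fully_labeled_glue ?szu.
    have /(perm_iotaP ltree0)[p pp eqzs] : perm_eq zs us by rewrite perm_sym.
    apply: (glue_iso_intro (p := p)) => // i lti.
    have [_] := zsP _ lti; rewrite eqzs (nth_map 0%N) //.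
    by rewrite (perm_size pp) size_iota szu.
  have [us [p [-> wfus szu pp isop]]] := glue_iso_elim ys0 wfys wfy isoy.
  apply: map_f; apply/flatten_mapP; exists (map (nth ltree0 us) p).
    have szp : size p = size ys by rewrite (perm_size pp) size_iota.
    apply/chP; rewrite size_map; split=> // i lti.
    rewrite (nth_map 0%N) ?szp //; split; last exact: isop.
    have : nth 0%N p i \in iota 0 (size us).
      by rewrite -(perm_mem pp) mem_nth ?szp.
    by rewrite mem_iota => /andP[_]; apply/all_nthP.
  rewrite mem_permutations perm_sym; apply/(perm_iotaP ltree0).
  by exists p.
- rewrite big_outdeg_node size_map size_flatten /shape -map_comp.
  rewrite (_ : map _ (choices rs) = map (fun=> (size ys)`!) (choices rs)).
    rewrite sumnE big_map big_const_seq count_predT iter_addn_0; congr muln.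
      by rewrite size_map.
    rewrite size_choices /rs big_map big_map [RHS](big_nth ltree0).
    rewrite /index_iota subn0; apply: eq_big_seq => i; rewrite mem_iota.
    by move=> /andP[_ lti]; have [_ _ ->] := RP _ lti.
  apply/eq_in_map => zs zsc /=; rewrite size_permutations ?uch //.
  by have /chP[-> _] := zsc.
Qed.

(** * Discrete random variables with constant mass *)

Section Probability.
Context (d : measure_display) (Omega : measurableType d) (R : realType).
Variable P : probability Omega R.

Lemma prob_image_ord (E : Type) (X : Omega -> E) (f : nat -> E) m :
  discrete_rv X -> {in `I_m &, injective f} ->
  P (X @^-1` (f @` `I_m)) = (\sum_(i < m) P (X @^-1` [set f i]))%E.
Proof.
move=> mX injf.
rewrite -(measure_semi_additive_ord_I P (F := fun i => X @^-1` [set f i])) //.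
- congr (P _).
  rewrite -(bigcup_mkord m (fun i => X @^-1` [set f i])).
  apply/seteqP; split=> w /=.
    by move=> [i lti fi]; exists i => //=; rewrite fi.
  by move=> [i lti ->]; exists i.
- apply/trivIsetP => i j lti ltj neij; apply/seteqP; split=> // w [/= -> eqf].
  by rewrite (injf i j) ?eqxx ?mem_set in neij.
- exact: bigsetU_measurable.
Qed.

Lemma prob_seq (E : eqType) (X : Omega -> E) (s : seq E) :
  discrete_rv X -> uniq s ->
  P (X @^-1` [set` s]) = (\sum_(a <- s) P (X @^-1` [set a]))%E.
Proof.
move=> mX us; case: s us => [_|a s us].
  by rewrite big_nil set_nil preimage_set0 measure0.
have -> : [set` a :: s] = nth a (a :: s) @` `I_(size (a :: s)).
  apply/seteqP; split=> b /= => [/(nthP a)[i lti <-]|[i lti <-]].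
    by exists i.
  exact: mem_nth.
rewrite prob_image_ord // ?(big_nth a) ?big_mkord //.
by move=> i j /set_mem lti /set_mem ltj /eqP; rewrite nth_uniq // => /eqP.
Qed.

Lemma prob_null_points (E : countType) (X : Omega -> E) (A : set E) :
  discrete_rv X -> (forall a, A a -> P (X @^-1` [set a]) = 0%E) ->
  P (X @^-1` A) = 0%E.
Proof.
move=> mX nullX.
pose F k := if unpickle k is Some a then X @^-1` ([set a] `&` A) else set0.
have -> : X @^-1` A = \bigcup_k F k.
  apply/seteqP; split=> w /= => [Aw|[k _]]; rewrite /F.
    by exists (pickle (X w)); rewrite // pickleK.
  by case: unpickle => // a [].
apply: measure_negligible.
  by apply: bigcup_measurable => k _; rewrite /F; case: unpickle.
apply: negligible_bigcup => k; rewrite /F; case: unpickle => [a|]; last first.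
  exact: negligible_set0.
have [Aa|nAa] := pselect (A a).
  exists (X @^-1` [set a]); split; [exact: mX | exact: nullX |].
  by move=> w [].
have -> : [set a] `&` A = set0 by apply/seteqP; split=> // b [->].
by rewrite preimage_set0; exact: negligible_set0.
Qed.

(** If [A] were infinite, arbitrarily many disjoint events of probability [q]
    would fit in a space of total mass 1.  So [A] has finitely many points, and
    their number times [q] is 1. *)
Lemma uniform_on_of_const (E : Type) (X : Omega -> E) (A : set E) (q : R) :
  discrete_rv X -> 0 < q -> (forall a, A a -> P (X @^-1` [set a]) = q%:E) ->
  P (X @^-1` A) = 1%E -> uniform_on P X A.
Proof.
move=> mX q0 PX PA; split=> //; elim/Ppointed: E => E in X A mX PX PA *.
  suff A0 : A = set0.
    move: PA; rewrite A0 preimage_set0 measure0 => /eqP.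
    by rewrite eq_sym onee_eq0.
  by rewrite empty_eq0.
have Pim (f : nat -> E) m : {in `I_m &, injective f} ->
    (forall i, (i < m)%N -> A (f i)) ->
    P (X @^-1` (f @` `I_m)) = (m%:R * q)%:E.
  move=> injf Af; rewrite prob_image_ord //.
  rewrite (eq_bigr (fun=> q%:E)) => [|i _]; last by apply/PX/Af.
  by rewrite sumEFin sumr_const card_ord mulr_natl.
have [m Am] : finite_set A.
  apply: contrapT => /infiniteP/pcard_leP[f].
  have Pf m : (m%:R * q <= 1).
    rewrite -lee_fin -(Pim f m); first exact: probability_le1.
      by move=> i j _ _; apply: inj; rewrite inE.
    by move=> i _; apply: funS.
  have := Pf (Num.truncn q^-1).+1; rewrite leNgt => /negP; apply.
  by rewrite -ltr_pdivrMr // div1r truncnS_gt.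
exists m; have /card_set_bijP[f [fA finj fsurj]] : (`I_m #= A)%card.
  by rewrite card_eq_sym.
have Af : A = f @` `I_m.
  apply/seteqP; split=> a; first by move/fsurj => [i]; exists i.
  by move=> [i lti <-]; apply: fA.
have := Pim f m finj (fun i lti => fA i lti); rewrite -Af PA => -[mq].
have m0 : (0 < m)%N.
  by case: (m) mq => //; rewrite mul0r => /eqP; rewrite oner_eq0.
split=> // a Aa; rewrite PX //; congr EFin.
have m0' : m%:R != 0 :> R by rewrite pnatr_eq0 -lt0n.
by apply: (mulfI m0'); rewrite -mq divff.
Qed.

End Probability.

(** * The offspring distributions *)

Section Offspring.
Variable R : realType.

(** The first terms of the offspring laws do not follow the general formula;
    the shift by [N] allows one to split them off. *)
Lemma nneseries_of_cvg (u : nat -> R) (l : R) N :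
  \sum_(0 <= k < n + N) u k @[n --> \oo] --> l ->
  (\sum_(0 <= k <oo) (u k)%:E = l%:E)%E.
Proof.
move=> ul; have {}ul : \sum_(0 <= k < n) u k @[n --> \oo] --> l.
  by move: ul; rewrite (cvg_shiftn N (fun n => \sum_(0 <= k < n) u k)).
have -> : (fun n => \sum_(0 <= k < n) (u k)%:E)%E =
          EFin \o (fun n => \sum_(0 <= k < n) u k).
  by apply/funext => n /=; rewrite sumEFin.
by rewrite EFin_lim; [rewrite (cvg_lim _ ul) | apply/cvg_ex; exists l].
Qed.

Lemma nneseries_le (u : nat -> R) (b : R) : (forall k, 0 <= u k) ->
  (forall n, \sum_(0 <= k < n) u k <= b) ->
  (\sum_(0 <= k <oo) (u k)%:E <= b%:E)%E.
Proof.
move=> u0 ub; apply: lime_le.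
  by apply: is_cvg_nneseries => n _ _; rewrite lee_fin.
by near=> n; rewrite sumEFin lee_fin.
Unshelve. all: by end_near. Qed.

Lemma offspring_xi1 : offspring_distribution (@xi1 R).
Proof.
split=> [[|[|[|k]]] /=|||]; rewrite ?invr_ge0 ?invr_gt0 //.
- apply: (@nneseries_of_cvg _ _ 3%N); apply: cvg_near_cst; near=> n.
  rewrite (@big_cat_nat _ _ _ 3%N) ?leq_addl //= [X in _ + X]big1_seq ?addr0.
    by rewrite !big_nat_recl // big_geq //=; lra.
  by move=> [|[|[|k]]] //; rewrite mem_index_iota.
- apply: nneseries_le => [[|[|[|k]]]|n]; rewrite ?mulr_ge0 ?invr_ge0 //.
  have [n3|/ltnW n3] := leqP 3 n.
    rewrite (@big_cat_nat _ _ _ 3%N) //= [X in _ + X]big1_seq ?addr0.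
      by rewrite !big_nat_recl // big_geq //=; lra.
    by move=> [|[|[|k]]]; rewrite mem_index_iota //= mulr0.
  by case: n n3 => [|[|[|[|n]]]] // _; do ?rewrite big_nat_recl //;
     rewrite big_geq //=; lra.
Unshelve. all: by end_near. Qed.

Lemma sqrt2_bounds : 1 < Num.sqrt 2 :> R /\ Num.sqrt 2 < 2 :> R.
Proof.
have s0 : 0 <= Num.sqrt 2 :> R by exact: sqrtr_ge0.
have s2 : Num.sqrt 2 ^+ 2 = 2 :> R by rewrite sqr_sqrtr.
by split; rewrite ltNge; apply/negP => ?; nra.
Qed.

(** Partial sums of the derivative of the geometric series, which gives the
    mean of [xi2]. *)
Lemma sum_geometric_deriv (x : R) n :
  (1 - x) ^+ 2 * \sum_(0 <= k < n) k.+1%:R * x ^+ k =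
  1 - n.+1%:R * x ^+ n + n%:R * x ^+ n.+1.
Proof.
elim: n => [|n IH]; first by rewrite big_geq // mulr0 expr0; ring.
by rewrite big_nat_recr //= mulrDr IH !exprS !mulrS; ring.
Qed.

Lemma offspring_xi2 : offspring_distribution (@xi2 R).
Proof.
have [s1 s2] := sqrt2_bounds.
have ss : Num.sqrt 2 * Num.sqrt 2 = 2 :> R by rewrite -expr2 sqr_sqrtr.
set q := (2 - Num.sqrt 2) / 2 :> R.
have q0 : 0 < q by rewrite /q; lra.
have q1 : q < 1 by rewrite /q; lra.
have xi2E k : xi2 R k.+2 = q ^+ k.+1 by [].
split=> [[|[|k]]|||] //=.
- by lra.
- by rewrite exprn_ge0 // ltW.
- have q1' : 1 - q != 0 by rewrite subr_eq0 gt_eqF.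
  transitivity ((2 - Num.sqrt 2 + q / (1 - q))%:E); last first.
    congr EFin; apply: (mulIf q1'); rewrite mulrDl divfK //.
    by rewrite /q; nra.
  apply: (@nneseries_of_cvg _ _ 2%N).
  have -> : (fun n => \sum_(0 <= k < n + 2) xi2 R k) =
            (fun n => 2 - Num.sqrt 2 + \sum_(0 <= k < n) q * q ^+ k).
    apply/funext => n; rewrite addn2 !big_nat_recl //= add0r; congr (_ + _).
    by apply: eq_bigr => k _; rewrite -exprS.
  have absq : `|q| < 1 by rewrite ger0_norm // ltW.
  exact: (cvgD (cvg_cst (2 - Num.sqrt 2)) (@cvg_geometric_series R q q absq)).
- by lra.
- apply: nneseries_le => [k|[|[|n]]].
  + case: k => [|[|k]]; rewrite ?mul0r ?mulr0 // mulr_ge0 // xi2E.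
    by rewrite exprn_ge0 // ltW.
  + by rewrite big_geq.
  + by rewrite big_nat1 mul0r.
  rewrite !big_nat_recl // mul0r mulr0 !add0r.
  under eq_bigr => k _ do rewrite xi2E.
  have := sum_geometric_deriv q n.+1.
  rewrite big_nat_recl // mulrDr => eqs.
  have : n.+1%:R * q ^+ n.+2 <= n.+2%:R * q ^+ n.+1.
    rewrite exprS [q * _]mulrC mulrA -[leRHS]mulr1.
    apply: ler_pM; [|exact: ltW| |exact: ltW].
      by rewrite mulr_ge0 // exprn_ge0 // ltW.
    by rewrite ler_pM2r ?exprn_gt0 // ler_nat.
  have q2 : (1 - q) ^+ 2 = 2^-1 by rewrite /q expr2; nra.
  move: eqs; rewrite q2 expr0 mulr1.
  by set S := \sum_(_ <= _ < _) _; lra.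
Qed.

Lemma ln2_gt_half : 2^-1 < ln 2 :> R.
Proof.
have l0 : 0 < ln 2 :> R by rewrite ln_gt0 // ltr1n.
have : 1 - ln 2 < expR (- ln 2) :> R by rewrite expR_gt1Dx // oppr_eq0 gt_eqF.
by rewrite expRN lnK ?posrE //; lra.
Qed.

Lemma cvg_exp_series (x : R) :
  \sum_(0 <= k < n) x ^+ k / k`!%:R @[n --> \oo] --> expR x.
Proof. exact: is_cvg_series_exp_coeff. Qed.

Lemma sum_exp_le (x : R) n : 0 <= x ->
  \sum_(0 <= k < n) x ^+ k / k`!%:R <= expR x.
Proof.
move=> x0; apply: (nondecreasing_cvgn_le _ (@is_cvg_series_exp_coeff R x)).
apply: nondecreasing_series => k _ _.
by rewrite /exp_coeff /= divr_ge0 // exprn_ge0.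
Qed.

Lemma offspring_xi4 : offspring_distribution (@xi4 R).
Proof.
have lh := ln2_gt_half.
have l0 : 0 < ln 2 :> R by lra.
have el : expR (ln 2) = 2 :> R by rewrite lnK // posrE.
have xi4_0 : 0 < xi4 R 0 by rewrite /= divr_gt0 //; lra.
have xi4_ge0 k : 0 <= xi4 R k.
  case: k => [|[|k]] //; first exact: ltW.
  by rewrite /= divr_ge0 // exprn_ge0 // ltW.
have xi4E k : xi4 R k.+2 = (ln 2)^-1 * (ln 2 ^+ k.+2 / k.+2`!%:R).
  by rewrite [in RHS]exprS !mulrA mulVf ?mul1r // gt_eqF.
split=> //.
(* From index 2 on, xi4 is the exponential series at ln 2 divided by ln 2; the
   constant corrects the terms of index 0 and 1. *)
- pose c : R := 2 * ln 2 - 1 - 1 - ln 2.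
  transitivity (((ln 2)^-1 * (expR (ln 2) + c))%:E); last first.
    by congr EFin; rewrite el /c; field; rewrite gt_eqF.
  apply: (@nneseries_of_cvg _ _ 2%N).
  have -> : (fun n => \sum_(0 <= k < n + 2) xi4 R k) = (fun n => (ln 2)^-1 *
      (\sum_(0 <= k < n + 2) ln 2 ^+ k / k`!%:R + c)).
    apply/funext => n; rewrite addn2 !big_nat_recl //.
    rewrite (eq_bigr _ (fun k _ => xi4E k)).
    rewrite -mulr_sumr /c /= (factS 0) fact0 expr0 expr1.
    by field; rewrite gt_eqF.
  have cv : \sum_(0 <= k < n + 2) ln 2 ^+ k / k`!%:R @[n --> \oo]
      --> expR (ln 2 : R).
    rewrite (cvg_shiftn 2 (fun n => \sum_(0 <= k < n) ln 2 ^+ k / k`!%:R)).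
    exact: cvg_exp_series.
  exact: (cvgM (cvg_cst (ln 2)^-1) (cvgD cv (cvg_cst c))).
- apply: nneseries_le => [k|[|n]]; [by rewrite mulr_ge0 | by rewrite big_geq |].
  (* The mean is the exponential series at ln 2 without its constant term. *)
  have xi4_mean k : k.+1%:R * xi4 R k.+1 = ln 2 ^+ k / k`!%:R - (k == 0%N)%:R.
    case: k => [|k]; first by rewrite mulr0 expr0 fact0 divr1 subrr.
    rewrite subr0 [xi4 _ _]/(_ / _) factS natrM invfM.
    by rewrite mulrCA mulVKf // pnatr_eq0.
  rewrite big_nat_recl // mul0r add0r (eq_bigr _ (fun k _ => xi4_mean k)).
  rewrite sumrB; have := sum_exp_le n (ltW l0); rewrite el.
  case: n => [|n]; first by rewrite !big_geq ?subr0.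
  rewrite [X in _ -> _ - X <= _]big_nat_recl //.
  rewrite [X in _ -> _ - (_ + X) <= _]big1 //=.
  by move: (\sum_(_ <= _ < _) _) => S; lra.
Qed.

End Offspring.

(** * Weights of trees with a given number of leaves *)

Definition degrees_in (D : nat -> Prop) (t : ptree) : Prop :=
  forall v, v \in vertices t -> D (outdeg t v).

Definition tree_weight (R : realType) (xi : nat -> R) (t : ptree) : R :=
  \prod_(v <- vertices t) xi (outdeg t v).

Lemma tree_weight0 (R : realType) (xi : nat -> R) (D : nat -> Prop) t :
  (forall k, ~ D k -> xi k = 0) -> ~ degrees_in D t -> tree_weight xi t = 0.
Proof.
move=> xi0 /existsNP[v] /not_implyP[vv nD]; rewrite /tree_weight.
by apply/eqP; rewrite prodf_seq_eq0; apply/hasP; exists v; rewrite //= xi0.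
Qed.

(** The identity [sum (outdeg v - 1) = n - 1] in multiplicative form.  With the
    extra factor [b] it is stable under gluing: a root with [k.+1] subtrees
    contributes [b ^+ k], so that each subtree receives its own factor [b]. *)
Lemma prod_geometric_outdeg (R : realType) (a b : R) t :
  b * \prod_(v <- vertices t)
        (if outdeg t v is k.+1 then b ^+ k else a) = (a * b) ^+ nleaves t.
Proof.
pose F k := if k is k'.+1 then b ^+ k' else a.
rewrite -[X in b * X]/(\prod_(v <- vertices t) F (outdeg t v)).
elim/ptree_nth_ind: t => -[|c cs] IH.
  by rewrite big_seq1 outdeg_root nleaves_pleaf expr1 mulrC.
rewrite big_outdeg_node /= mulrA -exprS nleaves_node // -/(size (c :: cs)).
have {}IH t : t \in c :: cs ->
    b * \prod_(v <- vertices t) F (outdeg t v) = (a * b) ^+ nleaves t.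
  by move=> /(nthP pleaf)[i lti <-]; apply: IH.
elim: (c :: cs) IH => [|t ts IHts] IH; first by rewrite big_nil mulr1.
rewrite big_cons exprS mulrACA IH ?mem_head // IHts ?exprD // => u uts.
by rewrite IH // inE uts orbT.
Qed.

(** The factor [g] is 1 for ordered trees, and the factorial for unordered
    ones, where it compensates the number of orderings of the children. *)
Lemma tree_weight_const (R : realType) (xi g : nat -> R) (D : nat -> Prop)
    (a b : R) t :
  b != 0 -> xi 0%N * g 0%N = a ->
  (forall k, D k.+1 -> xi k.+1 * g k.+1 = b ^+ k) ->
  degrees_in D t ->
  tree_weight xi t * \prod_(v <- vertices t) g (outdeg t v) =
  (a * b) ^+ nleaves t / b.
Proof.
move=> b0 xia xib Dt; rewrite -prod_geometric_outdeg [RHS]mulrC mulKf //.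
rewrite /tree_weight -big_split; apply: eq_big_seq => v /Dt /=.
by case: (outdeg t v) => [|k] Dk; [exact: xia | exact: xib].
Qed.

(** * Conditioned Galton-Watson trees *)

Lemma perm_iota1_label n (s : seq nat) : perm_eq s (iota 1 n) ->
  exists u : 'S_n, s = [seq (u k).+1 | k <- enum 'I_n].
Proof.
move=> ps; have szs : size s = n by rewrite (perm_size ps) size_iota.
have sP k : (k < n)%N -> (0 < nth 0%N s k <= n)%N.
  move=> ltk; have : nth 0%N s k \in iota 1 n.
    by rewrite -(perm_mem ps) mem_nth ?szs.
  by rewrite mem_iota add1n ltnS.
have gP (k : 'I_n) : ((nth 0%N s k).-1 < n)%N.
  by have := sP k (ltn_ord k); case: (nth 0%N s k).
pose g (k : 'I_n) := Ordinal (gP k).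
have gE (k : 'I_n) : (g k).+1 = nth 0%N s k.
  by have := sP k (ltn_ord k); rewrite /=; case: (nth 0%N s k).
have ginj : injective g.
  move=> i j eqg; apply/val_inj/eqP.
  have us : uniq s by rewrite (perm_uniq ps) iota_uniq.
  rewrite -(nth_uniq 0%N _ _ us) ?szs; [|exact: ltn_ord|exact: ltn_ord].
  by apply/eqP; have := gE j; rewrite -eqg gE.
exists (perm ginj); apply: (@eq_from_nth _ 0%N).
  by rewrite size_map size_enum_ord.
move=> i; rewrite szs => lti; rewrite (nth_map (Ordinal lti)) ?size_enum_ord //.
by rewrite permE gE nth_enum_ord.
Qed.

Lemma label_by_inj n t t' (u u' : 'S_n) :
  label_by t u = label_by t' u' -> t = t' /\ u = u'.
Proof.
move=> [-> eqs]; split=> //; apply/permP => k.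
by have /eq_in_map/(_ k (mem_enum _ k))[] := eqs => /val_inj.
Qed.

Lemma perm_label_by n t (u : 'S_n) : perm_eq (label_by t u).2 (iota 1 n).
Proof.
apply: uniq_perm; rewrite ?iota_uniq //.
  by rewrite map_inj_uniq ?enum_uniq // => i j [] /val_inj/perm_inj.
move=> i; rewrite mem_iota add1n ltnS; apply/mapP/idP => [[k _ ->]|].
  exact: (ltn_ord (u k)).
case: i => // i lti; exists ((u^-1)%g (Ordinal lti)); rewrite ?mem_enum //.
by rewrite permKV.
Qed.

Lemma forget_order_iso n x y :
  ltree_iso x y -> forget_order n x = forget_order n y.
Proof.
move=> isoxy; apply/seteqP; split=> z [lz isoz]; split=> //.
  exact: ltree_iso_trans (ltree_iso_sym isoxy) isoz.
exact: ltree_iso_trans isoxy isoz.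
Qed.

Section ConditionedTree.
Context (d : measure_display) (Omega : measurableType d) (R : realType).
Variable P : probability Omega R.
Variables (xi : nat -> R) (D : nat -> Prop) (n : nat) (T : Omega -> ptree).
Hypothesis xi_supp : forall k, ~ D k -> xi k = 0.
Hypothesis gwT : gw_given_leaves P xi n T.

(** The constant is the probability of having [n] leaves; were it 0, the law of
    the conditioned tree would have total mass 0, as division by 0 gives 0. *)
Lemma gw_given_leaves_mass : exists2 Z : R, 0 < Z &
  forall t, P (T @^-1` [set t]) =
    (if nleaves t == n then tree_weight xi t / Z else 0)%:E.
Proof.
have [_ [d0 [Om0 [P0 [T0 [[mT0 PT0] PT]]]]]] := gwT.
set N := [set w | nleaves (T0 w) = n] in PT.
exists (fine (P0 N)) => [|t].
  rewrite lt0r fine_ge0 // andbT; apply/eqP => Z0.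
  have := PT setT; rewrite Z0 invr0 mulr0 preimage_setT probability_setT.
  by move=> /eqP; rewrite onee_eq0.
rewrite PT; have [tn|tn] := eqVneq (nleaves t) n.
  rewrite setIidl; last by move=> w Tw; rewrite /N /= Tw.
  by rewrite PT0.
rewrite (_ : _ `&` _ = set0) ?measure0 ?mul0r //.
apply/seteqP; split=> // w [Tw]; rewrite /N /= Tw => /eqP.
by rewrite (negPf tn).
Qed.

(** A set of trees of weight 0 is negligible since there are only countably many
    finite trees. *)
Lemma gw_given_leaves_support :
  P (T @^-1` [set t | nleaves t = n /\ degrees_in D t]) = 1%E.
Proof.
have [mT _] := gwT; have [Z _ PT] := gw_given_leaves_mass.
set S := [set t | _]; suff : P (T @^-1` (~` S)) = 0%E.
  rewrite -preimage_setC probability_setC //.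
  have := probability_le1 P (mT S); have := measure_ge0 P (T @^-1` S).
  case: (P _) => // p _ _ [] /eqP; rewrite subr_eq0 => /eqP <- //.
apply: prob_null_points => // t nSt; rewrite PT; case: eqP => // tn.
rewrite (tree_weight0 xi_supp) ?mul0r // => Dt.
by apply: nSt; split.
Qed.

Lemma gw_given_leaves_uniform (K : R) : 0 < K ->
  (forall t, nleaves t = n -> degrees_in D t -> tree_weight xi t = K) ->
  uniform_on P T [set t | nleaves t = n /\ degrees_in D t].
Proof.
move=> K0 WK; have [mT _] := gwT; have [Z Z0 PT] := gw_given_leaves_mass.
apply: (uniform_on_of_const (q := K / Z)) => //; first exact: divr_gt0.
  by move=> t [tn Dt]; rewrite PT tn eqxx WK.
exact: gw_given_leaves_support.
Qed.

Variable U : Omega -> 'S_n.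
Hypothesis unifU : uniform_on P U [set: 'S_n].
Hypothesis indUT : independent_rv P U T.

Let Y w := label_by (T w) (U w).

Lemma discrete_label_by : discrete_rv Y.
Proof.
move=> B; have [mT _] := gwT; have [mU _] := unifU.
have -> : Y @^-1` B = \bigcup_(u in [set: 'S_n])
    (U @^-1` [set u] `&` T @^-1` [set t | B (label_by t u)]).
  by apply/seteqP; split=> w /= => [Bw|[u _ [<-]]] //; exists (U w).
apply: countable_bigcupT_measurable => [|u]; first exact: countableP.
exact: measurableI.
Qed.

Lemma label_by_mass : exists2 c : R, 0 < c &
  forall y, leaf_labeled n y ->
    P (Y @^-1` [set y]) = (c * tree_weight xi y.1)%:E.
Proof.
have [mU [m [m0 _ PU]]] := unifU; have [Z Z0 PT] := gw_given_leaves_mass.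
exists (m%:R^-1 / Z) => [|[t s] [/= tn /perm_iota1_label[u ->]]].
  by rewrite divr_gt0 // invr_gt0 ltr0n.
have -> : Y @^-1` [set (t, [seq (u k).+1 | k <- enum 'I_n])] =
    U @^-1` [set u] `&` T @^-1` [set t].
  apply/seteqP; split=> w /=; first by move=> /label_by_inj[].
  by move=> [Uw Tw]; rewrite /Y Uw Tw.
by rewrite indUT PU // PT tn eqxx -EFinM mulrA mulrAC.
Qed.

(** The event that the unordered tree of [x] is obtained is the disjoint union,
    over the ordered representatives [y] of it, of the events [Y = y].  Each of
    these has mass [c * K / prod (outdeg v)!], and their number is this same
    product, which is an isomorphism invariant. *)
Lemma gw_given_leaves_uniform_unordered (K : R) : 0 < K ->
  (forall t, nleaves t = n -> degrees_in D t ->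
     tree_weight xi t * \prod_(v <- vertices t) (outdeg t v)`!%:R = K) ->
  uniform_on P (fun w => forget_order n (Y w))
    (unordered_labeled_trees n (degrees_in D)).
Proof.
move=> K0 WK; have [c c0 PY] := label_by_mass.
have mX : discrete_rv (fun w => forget_order n (Y w)).
  by move=> A; exact: (discrete_label_by (forget_order n @^-1` A)).
apply: (uniform_on_of_const (q := c * K)) => //; first exact: mulr_gt0.
- move=> _ [x [[xn px] Dx] <-].
  have wfx : fully_labeled x.
    by rewrite /fully_labeled (perm_size px) size_iota xn.
  have ux : uniq x.2 by rewrite (perm_uniq px) iota_uniq.
  have [r [ur rP szr]] := iso_class_enumeration wfx ux.
  have -> : (fun w => forget_order n (Y w)) @^-1` [set forget_order n x] =
      Y @^-1` [set` r].
    apply/seteqP; split=> w /= => [eqX|/rP[_ isoY]]; last first.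
      by rewrite (forget_order_iso n isoY).
    have [_ isoY] : forget_order n (Y w) x.
      by rewrite eqX; split; [split | exact: ltree_iso_refl].
    apply/rP; split; last exact: ltree_iso_sym.
    rewrite /fully_labeled (ltree_iso_nleaves isoY) xn.
    by rewrite (perm_size (perm_label_by _ _)) size_iota.
  rewrite prob_seq //; last exact: discrete_label_by.
  rewrite (eq_big_seq (fun=> (c * (K / (size r)%:R))%:E)) => [|y /rP[wfy isoy]].
    rewrite sumEFin big_const_seq count_predT iter_addr_0 -(mulr_natr (c * _)).
    rewrite -!mulrA mulVf ?mulr1 // pnatr_eq0 size_eq0.
    have : x \in r by apply/rP; split; last exact: ltree_iso_refl.
    by case: (r).
  rewrite PY; last first.
    split; first by rewrite -(ltree_iso_nleaves isoy).
    by apply: perm_trans px; rewrite perm_sym ltree_iso_perm_labels.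
  rewrite -(WK y.1) -?(ltree_iso_nleaves isoy) //; last first.
    exact: ltree_iso_outdeg isoy Dx.
  rewrite szr natr_prod (ltree_iso_big _ (fun k => k`!%:R) isoy) mulfK //.
  rewrite prodf_seq_neq0; apply/allP => v _.
  by rewrite pnatr_eq0 -lt0n fact_gt0.
- apply/eqP; rewrite eq_le probability_le1 //=.
  rewrite -gw_given_leaves_support; apply: le_measure; rewrite ?inE //.
    by have [mT _] := gwT; exact: mT.
  move=> w [Tn DT]; exists (Y w) => //; split=> //; split=> //.
  exact: perm_label_by.
Qed.

End ConditionedTree.

Theorem theorem1 (R : realType) :
  [/\ offspring_distribution (@xi1 R), offspring_distribution (@xi2 R),
      offspring_distribution (@xi3 R) & offspring_distribution (@xi4 R)] /\
  forall (n : nat), (0 < n)%N ->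
  forall (d : measure_display) (Omega : measurableType d)
         (P : probability Omega R) (T : Omega -> ptree),
    (gw_given_leaves P (@xi1 R) n T ->
       uniform_on P T [set t | nleaves t = n /\ binary t]) /\
    (gw_given_leaves P (@xi2 R) n T ->
       uniform_on P T [set t | nleaves t = n /\ no_unary t]) /\
    forall U : Omega -> 'S_n,
      uniform_on P U [set: 'S_n] -> independent_rv P U T ->
      (gw_given_leaves P (@xi3 R) n T ->
         uniform_on P (fun w => forget_order n (label_by (T w) (U w)))
                    (unordered_labeled_trees n binary)) /\
      (gw_given_leaves P (@xi4 R) n T ->
         uniform_on P (fun w => forget_order n (label_by (T w) (U w)))
                    (unordered_labeled_trees n no_unary)).
Proof.
split; first by split; [exact: offspring_xi1 | exact: offspring_xi2
  | exact: offspring_xi1 | exact: offspring_xi4].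
move=> n n0 d Omega P T.
have half0 : 2^-1 != 0 :> R by rewrite invr_eq0 pnatr_eq0.
have supp_bin k : ~ (k = 0%N \/ k = 2%N) -> xi1 R k = 0.
  by case: k => [|[|[|k]]] // []; [left | right].
have prod1 t : \prod_(v <- vertices t) (1 : R) = 1 by rewrite big1.
have [s1 s2] := sqrt2_bounds R; have lh := ln2_gt_half R.
have l0 : 0 < ln 2 :> R by lra.
split.
  move=> gwT; apply: (gw_given_leaves_uniform supp_bin gwT
    (K := (2^-1 * 2^-1) ^+ n / 2^-1)).
    by rewrite divr_gt0 ?exprn_gt0 ?mulr_gt0 // invr_gt0.
  move=> t <- Dt.
  rewrite -(tree_weight_const (xi := xi1 R) (g := fun=> 1) half0 _ _ Dt).
  - by rewrite prod1 mulr1.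
  - by rewrite mulr1.
  - by move=> k [|[->]] //; rewrite mulr1 expr1.
split.
  set q : R := (2 - Num.sqrt 2) / 2; have q0 : 0 < q by rewrite /q; lra.
  have supp k : ~ (k <> 1%N) -> xi2 R k = 0 by move/contrapT => ->.
  move=> gwT; apply: (gw_given_leaves_uniform supp gwT
    (K := ((2 - Num.sqrt 2) * q) ^+ n / q)).
    by rewrite divr_gt0 ?exprn_gt0 ?mulr_gt0 //; lra.
  move=> t <- Dt.
  rewrite -(tree_weight_const (xi := xi2 R) (g := fun=> 1)
    (lt0r_neq0 q0) _ _ Dt).
  - by rewrite prod1 mulr1.
  - by rewrite mulr1.
  - by move=> [|k] // _; rewrite mulr1.
move=> U unifU indUT; split.
  move=> gwT; apply: (gw_given_leaves_uniform_unordered supp_bin gwT unifU indUT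
    (K := (2^-1 * 1) ^+ n / 1)).
    by rewrite divr1 exprn_gt0 // mulr1 invr_gt0.
  move=> t <- Dt.
  rewrite -(tree_weight_const (xi := xi1 R) (g := fun k => k`!%:R)
    (oner_neq0 R) _ _ Dt) //.
  - by rewrite fact0 mulr1.
  - by move=> k [|[->]] //; rewrite expr1 /= mulVf // pnatr_eq0.
have supp k : ~ (k <> 1%N) -> xi4 R k = 0 by move/contrapT => ->.
move=> gwT; apply: (gw_given_leaves_uniform_unordered supp gwT unifU indUT
    (K := (xi4 R 0 * ln 2) ^+ n / ln 2)).
  have [_ _ x0 _] := offspring_xi4 R.
  by apply: divr_gt0 => //; apply: exprn_gt0; apply: mulr_gt0.
move=> t <- Dt.
rewrite -(tree_weight_const (xi := xi4 R) (g := fun k => k`!%:R)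
  (lt0r_neq0 l0) _ _ Dt) //.
- by rewrite fact0 mulr1.
- by move=> [|k] // _; rewrite /= divfK // pnatr_eq0 -lt0n fact_gt0.
Qed.
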